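(* Let $\partial_t u(t,x) = f(x,u(t,\cdot))$ be a PDE whose right-hand side has the Hamiltonian form $f(\cdot,v)=\mathcal{J}(v)\frac{\delta H}{\delta u}(v)$ for all $v\in\mathcal{U}$, where the Hamiltonian $H:\mathcal{U}\to\mathbb{R}$ is the integral of a Hamiltonian density and the operator $\mathcal{J}$ is pointwise skew-adjoint, i.e. $\langle q_1,\mathcal{J}(v)q_2\rangle_\nu=-\langle \mathcal{J}(v)q_1,q_2\rangle_\nu$ for all $v,q_1,q_2\in\mathcal{U}$. Assume that $H$ is factorizable, with associated functions $h:\mathbb{R}^m\to\mathbb{R}$ and $Q:\mathbb{R}^m\to\mathbb{R}^{m\times m}$. Let $\hat u$ be a separable parametrization $\hat u(\theta,x)=\sum_{i=1}^{n_\Phi}\beta_i\,\phi_i(x,\alpha_i)$. Then any solution $\theta:\mathcal{T}\to\mathbb{R}^p$ of the corresponding time-continuous weighted Neural Galerkin system $$M_Q(\theta(t))\,\dot\theta(t)=F_Q(\theta(t)),\qquad t\in\mathcal{T},$$ preserves the Hamiltonian $H$ in the sense that $$\frac{\mathrm{d}}{\mathrm{d}t}H(\theta(t))=0\quad\text{for all }t\in\mathcal{T},$$ where $H(\theta)$ is short-hand for $H(\hat u(\theta,\cdot))$.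
   Context: **Spaces.** $\mathcal{T}\subseteq\mathbb{R}$ is the time interval, $\Omega\subseteq\mathbb{R}^d$ the spatial domain, and $\nu$ a fully supported measure on $\Omega$. $\mathcal{U}$ and $\mathcal{Z}$ are subspaces of $L^2(\Omega)^m$ (square-integrable $\mathbb{R}^m$-valued functions with respect to $\nu$) consisting of functions that allow point-wise evaluation; boundary conditions of the PDE are encoded in $\mathcal{U}$. $\langle\cdot,\cdot\rangle_\nu$ is the $L^2$ inner product with respect to $\nu$, i.e. $\langle f,g\rangle_\nu=\int_\Omega f(x)^\top g(x)\,\mathrm{d}\nu(x)$. **Hamiltonian structure.** For each $v\in\mathcal{U}$, $\mathcal{J}(v):\mathcal{U}\to\mathcal{Z}$ is a linear operator. $\frac{\delta H}{\delta u}$ is the variational derivative of $H$ (the gradient with respect to $\langle\cdot,\cdot\rangle_\nu$), which attains values in $\mathcal{U}$, so that $\frac{\mathrm{d}}{\mathrm{d}t}H(v(t,\cdot))=\langle \frac{\delta H}{\delta u}(v(t,\cdot)),\partial_t v(t,\cdot)\rangle_\nu$ along differentiable curves in $\mathcal{U}$. **Factorizable Hamiltonian.** $H$ is called factorizable if there exist a continuously differentiable function $h:\mathbb{R}^m\to\mathbb{R}$ and a point-wise symmetric and positive definite matrix function $Q:\mathbb{R}^m\to\mathbb{R}^{m\times m}$ such that $$H(v)=\int_\Omega h(v(x))\,\mathrm{d}\nu(x)\quad\text{and}\quad\Big(\tfrac{\delta H}{\delta u}(v)\Big)(x)=Q(v(x))\,v(x)\quad\text{for all }(v,x)\in\mathcal{U}\times\Omega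 .$$ For $v\in\mathcal{U}$, $Q(v)$ also denotes the operator of pointwise multiplication by $Q(v(x))$. **Separable parametrization.** $\hat u(\theta,x)=\sum_{i=1}^{n_\Phi}\beta_i\,\phi_i(x,\alpha_i)$ with $\beta_i\in\mathbb{R}^m$, $\alpha_i\in\mathbb{R}^{q_i}$, $\phi_i:\Omega\times\mathbb{R}^{q_i}\to\mathbb{R}$. Put $\alpha=[\alpha_1^\top,\dots,\alpha_{n_\Phi}^\top]^\top\in\mathbb{R}^{q}$ with $q=\sum_{s=1}^{n_\Phi}q_s$, $\beta=[\beta_1^\top,\dots,\beta_{n_\Phi}^\top]^\top\in\mathbb{R}^{n_\Phi m}$, and $\theta=[\alpha^\top,\beta^\top]^\top\in\mathbb{R}^p$, $p=n_\Phi m+q$. The parametrization is continuously differentiable in the parameter, and $\hat u(\theta,\cdot)\in\mathcal{U}$ for all $\theta\in\mathbb{R}^p$. Along a trajectory, $\theta(t)=[\alpha(t)^\top,\beta(t)^\top]^\top$. Let $$V(x,\alpha)=[\phi_1(x,\alpha_1),\dots,\phi_{n_\Phi}(x,\alpha_{n_\Phi})]\otimes I_m\in\mathbb{R}^{m\times n_\Phi m}$$ (Kronecker product, $I_m$ the identity), so that $\hat u(\theta,x)=V(x,\alpha)\beta$. $e_i$ denotes the $i$th canonical unit vector (of the appropriate dimension), and $\partial_\alpha V(x,\alpha)(e_i)\in\mathbb{R}^{m\times n_\Phi m}$ is the partial derivative of $V(x,\cdot)$ at $\alpha$ in direction $e_i$. **Weighted Neural Galerkin system.** Define $M_Q:\mathbb{R}^p\to\mathbb{R}^{p\times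 p}$ and $F_Q:\mathbb{R}^p\to\mathbb{R}^p$ by $$M_Q(\theta)=\begin{bmatrix}M^{(11)}(\theta)&M^{(12)}(\theta)\\ M^{(12)}(\theta)^\top&M^{(22)}(\theta)\end{bmatrix},\qquad F_Q(\theta)=\begin{bmatrix}F^{(1)}(\theta)\\ F^{(2)}(\theta)\end{bmatrix},$$ where, for $i,j=1,\dots,q$ and $k,\ell=1,\dots,n_\Phi m$, and writing $\hat u=\hat u(\theta,\cdot)$, $$\begin{aligned} M^{(11)}_{ij}(\theta)&=\langle Q(\hat u)\,\partial_\alpha V(\cdot,\alpha)(e_i)\beta,\ \partial_\alpha V(\cdot,\alpha)(e_j)\beta\rangle_\nu,\\ M^{(12)}_{i\ell}(\theta)&=\langle Q(\hat u)\,\partial_\alpha V(\cdot,\alpha)(e_i)\beta,\ V(\cdot,\alpha)e_\ell\rangle_\nu,\\ M^{(22)}_{k\ell}(\theta)&=\langle Q(\hat u)V(\cdot,\alpha)e_k,\ V(\cdot,\alpha)e_\ell\rangle_\nu,\\ F^{(1)}_i(\theta)&=\langle Q(\hat u)\,\partial_\alpha V(\cdot,\alpha)(e_i)\beta,\ \mathcal{J}(\hat u)Q(\hat u)\hat u\rangle_\nu,\\ F^{(2)}_k(\theta)&=\langle Q(\hat u)V(\cdot,\alpha)e_k,\ \mathcal{J}(\hat u)Q(\hat u)\hat u\rangle_\nu . \end{aligned}$$ *)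

(* Defs.v *)
From HB Require Import structures.
From mathcomp Require Import all_boot all_order all_algebra.
From mathcomp Require Export mxtens.
From mathcomp Require Import all_classical all_reals all_analysis.

Set Implicit Arguments.
Unset Strict Implicit.
Unset Printing Implicit Defensive.

Import Order.TTheory GRing.Theory Num.Theory.
Import numFieldNormedType.Exports.

Local Open Scope classical_set_scope.
Local Open Scope ring_scope.

(* A MathComp measurableType is pointed, so the spatial domain comes with an
   arbitrary base point; nothing else depends on that point. *)
Definition pointed_dom {R : realType} {d : nat} {Om : set 'cV[R]_d}
  (x0 : Om) : Type := Om.
HB.instance Definition _ (R : realType) (d : nat) (Om : set 'cV[R]_d)
  (x0 : Om) := Choice.copy (pointed_dom x0) (set_type Om).
HB.instance Definition _ (R : realType) (d : nat) (Om : set 'cV[R]_d)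
  (x0 : Om) := isPointed.Build (pointed_dom x0) x0.

(* Om, as a type, with the Borel sigma-algebra of its subspace topology. *)
Notation borel_dom x0 :=
  (g_sigma_algebraType (@open _ : set (set (pointed_dom x0)))).

Section Derivatives.
Context {R : realType}.

(* The derivative relative to T is the two-sided one at interior points of an
   interval T and the one-sided one at the endpoints that belong to T. *)
Definition has_deriv_in {W : normedModType R} (T : set R) (g : R -> W)
    (t : R) (l : W) : Prop :=
  (s - t)^-1 *: (g s - g t) @[s --> within T t^'] --> l.

Definition nondegenerate_interval (T : set R) : Prop :=
  is_interval T /\ exists a b, [/\ T a, T b & a < b].

Definition C1 {n : nat} {W : normedModType R} (f : 'cV[R]_n -> W) : Prop :=
  (forall a, differentiable f a) /\ (forall v, continuous ('D_v f)).

Definition posdef {m : nat} (A : 'M[R]_m) : Prop :=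
  forall y : 'cV[R]_m, y != 0 -> 0 < (y^T *m A *m y) 0 0.

End Derivatives.

Section Spaces.
Context {R : realType} {d m : nat} {Om : set 'cV[R]_d} {x0 : Om}.
Variable nu : {measure set (borel_dom x0) -> \bar R}.
Implicit Types (f g : Om -> 'cV[R]_m) (U Z : set (Om -> 'cV[R]_m)).

Definition fully_supported : Prop :=
  forall O : set Om, open O -> O !=set0 -> (0 < nu O)%E.

(* Functions rather than almost-everywhere classes, since pointwise evaluation
   is needed. *)
Definition L2 f : Prop :=
  forall i, (fun x : borel_dom x0 => f x i 0) \in Lfun nu 2%:E.

Definition dot f g : borel_dom x0 -> R := fun x => ((f x)^T *m g x) 0 0.

Definition inner f g : R := (\int[nu]_x dot f g x)%R.

(* The integral defining [inner f g] exists; otherwise [inner f g] is a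
   conventional value. *)
Definition inner_defined f g : Prop := nu.-integrable setT (EFin \o dot f g).

Definition L2norm f : R := Num.sqrt (inner f f).

Definition L2_subspace U : Prop :=
  [/\ (forall f, U f -> L2 f), U (fun=> 0) &
      forall (a : R) f g, U f -> U g -> U (fun x => a *: f x + g x)].

Definition linear_operator U Z
    (A : (Om -> 'cV[R]_m) -> (Om -> 'cV[R]_m)) : Prop :=
  (forall f, U f -> Z (A f)) /\
  (forall (a : R) f g, U f -> U g ->
     A (fun x => a *: f x + g x) = (fun x => a *: A f x + A g x)).

Definition skew_adjoint U
    (A : (Om -> 'cV[R]_m) -> (Om -> 'cV[R]_m)) : Prop :=
  forall q1 q2, U q1 -> U q2 -> inner q1 (A q2) = - inner (A q1) q2.

(* v is differentiable as a curve in U with the L2 norm, and its L2 derivative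
   is the pointwise partial derivative; the derivative need not lie in U. *)
Definition differentiable_curve U (T : set R)
    (v dv : R -> Om -> 'cV[R]_m) : Prop :=
  forall t, T t ->
    [/\ U (v t), L2 (dv t),
        (forall x, has_deriv_in T (v ^~ x) t (dv t x)) &
        L2norm (fun x => (s - t)^-1 *: (v s x - v t x) - dv t x)
          @[s --> within T t^'] --> (0 : R)].

(* The gradient with respect to [inner]: a U-valued map satisfying the chain
   rule along differentiable curves in U. *)
Definition variational_derivative U (H : (Om -> 'cV[R]_m) -> R)
    (dH : (Om -> 'cV[R]_m) -> (Om -> 'cV[R]_m)) : Prop :=
  (forall v, U v -> U (dH v)) /\
  (forall (T : set R) v dv, nondegenerate_interval T ->
     differentiable_curve U T v dv ->
     forall t, T t -> has_deriv_in T (H \o v) t (inner (dH (v t)) (dv t))).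

Definition factorizable U (H : (Om -> 'cV[R]_m) -> R)
    (dH : (Om -> 'cV[R]_m) -> (Om -> 'cV[R]_m))
    (h : 'cV[R]_m -> R) (Q : 'cV[R]_m -> 'M[R]_m) : Prop :=
  [/\ C1 h,
      (forall y, (Q y)^T = Q y /\ posdef (Q y)),
      (forall v, U v ->
         nu.-integrable setT (fun x : borel_dom x0 => (h (v x))%:E) /\
         H v = (\int[nu]_(x in [set: borel_dom x0]) h (v x))%R) &
      (forall v x, U v -> dH v x = Q (v x) *m v x)].

(* Continuous differentiability in the parameter, both pointwise on Om and for
   the L2 norm, where the Frechet derivative is the pointwise one. *)
Definition C1_param {p : nat} (uh : 'cV[R]_p -> Om -> 'cV[R]_m) : Prop :=
  [/\ (forall x, C1 (uh ^~ x)),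
      (forall th eta, L2 (fun x => 'D_eta (uh ^~ x) th)),
      (forall th,
         L2norm (fun x => uh (th + eta) x - uh th x - 'D_eta (uh ^~ x) th)
           / `|eta| @[eta --> (0 : 'cV[R]_p)^'] --> (0 : R)) &
      (forall th eta,
         L2norm (fun x => 'D_eta (uh ^~ x) th' - 'D_eta (uh ^~ x) th)
           @[th' --> th] --> (0 : R))].

End Spaces.

Section SeparableParametrization.
Context {R : realType} {d m nPhi : nat} {q_ : 'I_nPhi -> nat}.
Context {Om : set 'cV[R]_d}.
Variable phi : forall i : 'I_nPhi, Om -> 'cV[R]_(q_ i) -> R.
Local Notation q := (\sum_(i < nPhi) q_ i)%N.
Implicit Types (alpha : 'cV[R]_q) (beta : 'cV[R]_(nPhi * m)).

(* The i-th block, of height m, of the stacked vector beta. *)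
Definition beta_block beta (i : 'I_nPhi) : 'cV[R]_m :=
  \col_j beta (mxtens_index (i, j)) 0.

(* theta = [alpha; beta] *)
Definition uhat (theta : 'cV[R]_(q + nPhi * m)) (x : Om) : 'cV[R]_m :=
  \sum_(i < nPhi) phi x (submxcol (usubmx theta) i) *:
    beta_block (dsubmx theta) i.

(* Kronecker product with the identity; the cast rewrites the height 1 * m. *)
Definition Vmx (x : Om) alpha : 'M[R]_(m, nPhi * m) :=
  castmx (mul1n m, erefl)
    ((\row_(i < nPhi) phi x (submxcol alpha i)) *t (1%:M : 'M[R]_m)).

End SeparableParametrization.

Section WeightedNeuralGalerkin.
Context {R : realType} {d m nPhi : nat} {q_ : 'I_nPhi -> nat}.
Context {Om : set 'cV[R]_d} {x0 : Om}.
Variable nu : {measure set (borel_dom x0) -> \bar R}.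
Variable J : (Om -> 'cV[R]_m) -> (Om -> 'cV[R]_m) -> (Om -> 'cV[R]_m).
Variable Q : 'cV[R]_m -> 'M[R]_m.
Variable phi : forall i : 'I_nPhi, Om -> 'cV[R]_(q_ i) -> R.
Local Notation q := (\sum_(i < nPhi) q_ i)%N.
Local Notation nb := (nPhi * m)%N.
Implicit Type theta : 'cV[R]_(q + nb).

Definition Qmul (v w : Om -> 'cV[R]_m) : Om -> 'cV[R]_m :=
  fun x => Q (v x) *m w x.

Definition dV_beta theta (i : 'I_q) : Om -> 'cV[R]_m :=
  fun x => 'D_(delta_mx i 0 : 'cV[R]_q) (Vmx phi x) (usubmx theta)
             *m dsubmx theta.

Definition V_unit theta (k : 'I_nb) : Om -> 'cV[R]_m :=
  fun x => Vmx phi x (usubmx theta) *m delta_mx k 0.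

Definition rhs theta : Om -> 'cV[R]_m :=
  J (uhat phi theta) (Qmul (uhat phi theta) (uhat phi theta)).

Local Notation QdV theta i := (Qmul (uhat phi theta) (dV_beta theta i)).
Local Notation QV theta k := (Qmul (uhat phi theta) (V_unit theta k)).

Definition M11 theta : 'M[R]_q :=
  \matrix_(i, j) inner nu (QdV theta i) (dV_beta theta j).
Definition M12 theta : 'M[R]_(q, nb) :=
  \matrix_(i, l) inner nu (QdV theta i) (V_unit theta l).
Definition M22 theta : 'M[R]_nb :=
  \matrix_(k, l) inner nu (QV theta k) (V_unit theta l).
Definition F1 theta : 'cV[R]_q := \col_i inner nu (QdV theta i) (rhs theta).
Definition F2 theta : 'cV[R]_nb := \col_k inner nu (QV theta k) (rhs theta).

Definition MQ theta : 'M[R]_(q + nb) :=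
  block_mx (M11 theta) (M12 theta) (M12 theta)^T (M22 theta).
Definition FQ theta : 'cV[R]_(q + nb) := col_mx (F1 theta) (F2 theta).

(* All the integrals in the entries of MQ and FQ exist, so that MQ and FQ are
   the intended real matrices for every parameter. *)
Definition MQ_FQ_well_defined : Prop :=
  forall theta,
    [/\ (forall i j, inner_defined nu (QdV theta i) (dV_beta theta j)),
        (forall i l, inner_defined nu (QdV theta i) (V_unit theta l)),
        (forall k l, inner_defined nu (QV theta k) (V_unit theta l)),
        (forall i, inner_defined nu (QdV theta i) (rhs theta)) &
        (forall k, inner_defined nu (QV theta k) (rhs theta))].

Definition NG_solution (T : set R) (theta dtheta : R -> 'cV[R]_(q + nb)) :
    Prop :=
  forall t, T t ->
    has_deriv_in T theta t (dtheta t) /\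
    MQ (theta t) *m dtheta t = FQ (theta t).

End WeightedNeuralGalerkin.

(* Main.v *)
Require Import Defs.
From HB Require Import structures.
From mathcomp Require Import all_boot all_order all_algebra.
From mathcomp Require Import all_classical all_reals all_analysis.
From mathcomp Require Import ring lra.
Import Order.TTheory GRing.Theory Num.Theory.
Import numFieldNormedType.Exports.
Local Open Scope classical_set_scope.
Local Open Scope ring_scope.

Set Implicit Arguments.
Unset Strict Implicit.
Unset Printing Implicit Defensive.

(** The Hamiltonian is conserved because the weighted Galerkin system makes the
    velocity of the state orthogonal to the variational derivative of [H].

    Write [u] for the parametrized state along the trajectory and [du] for its
    time derivative.  The chain rule that defines the variational derivative
    gives dH/dt = <dH(u), du> = <Q(u) u, du>.  The derivative [du] is the
    combination, with coefficients the entries of [dtheta], of the tangent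
    functions [dV_beta i] and [V_unit k] ([derive_uhat]).  Hence the lower
    block row of [MQ theta *m dtheta = FQ theta] says that
    <Q(u) V_k, du> = <Q(u) V_k, J(u) Q(u) u> for every [k]; the symmetry of [Q]
    enters here, since the lower left block of [MQ] is a transpose
    ([inner_derive_uhat]).  The parametrization is linear in the coefficients
    [beta], so [u] itself is a combination of the [V_k]: it lies in the test
    space.  Summing the equations with the weights [beta k] gives
    <Q(u) u, du> = <Q(u) u, J(u) Q(u) u> ([inner_Quhat_derive]).  The right-hand
    side is <g, J(u) g> with [g = Q(u) u = dH(u)] in [U], which vanishes by
    skew-adjointness ([skew_adjoint_diag]).

    The analytic work is to show that t |-> u(t) is a differentiable curve in
    the L2 norm, so that the chain rule for [H] applies ([C1_param_curve]).
    Its difference quotient minus [du] splits into the quotient of the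
    first-order remainder of the parametrization, which is negligible because
    theta is differentiable ([has_deriv_in_cvg_remainder]), and the derivative
    of the parametrization in a direction that tends to 0, which is a finite
    combination of fixed L2 functions with vanishing coefficients
    ([cvg_inner_sum]). *)

(** * The L2 inner product *)

Section InnerProduct.
Context {R : realType} {d m : nat} {Om : set 'cV[R]_d} {x0 : Om}.
Variable nu : {measure set (borel_dom x0) -> \bar R}.
Implicit Types f g : Om -> 'cV[R]_m.

Lemma dotC f g : dot (x0 := x0) f g = dot g f.
Proof.
by apply/funext => x; rewrite /dot !mxE; apply: eq_bigr => i _; rewrite !mxE mulrC.
Qed.

Lemma innerC f g : inner nu f g = inner nu g f.
Proof. by rewrite /inner dotC. Qed.

Lemma inner_definedC f g : inner_defined nu f g -> inner_defined nu g f.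
Proof. by rewrite /inner_defined dotC. Qed.

Lemma dot_combr f (a : R) g1 g2 :
  dot (x0 := x0) f (fun x => a *: g1 x + g2 x) =
  (fun x => a * dot (x0 := x0) f g1 x + dot (x0 := x0) f g2 x).
Proof.
by apply/funext => x; rewrite /dot mulmxDr -scalemxAr !mxE.
Qed.

Lemma inner_defined_combr f (a : R) g1 g2 :
  inner_defined nu f g1 -> inner_defined nu f g2 ->
  inner_defined nu f (fun x => a *: g1 x + g2 x).
Proof.
move=> i1 i2; rewrite /inner_defined dot_combr.
exact: (integrableD measurableT (integrableZl measurableT a i1) i2).
Qed.

Lemma inner_combr f (a : R) g1 g2 :
  inner_defined nu f g1 -> inner_defined nu f g2 ->
  inner nu f (fun x => a *: g1 x + g2 x) = a * inner nu f g1 + inner nu f g2.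
Proof.
move=> i1 i2; rewrite /inner dot_combr RintegralD//; first by rewrite RintegralZl.
exact: (integrableZl measurableT a i1).
Qed.

Lemma dot0r f : dot (x0 := x0) f (fun=> 0) = fun=> 0.
Proof. by apply/funext => x; rewrite /dot mulmx0 mxE. Qed.

(** Definedness and value are proved together: each step of the induction needs
    the integrability of the partial sum. *)
Lemma inner_sumr_def {I : finType} f (a : I -> R) (g : I -> Om -> 'cV[R]_m) :
  (forall i, inner_defined nu f (g i)) ->
  inner_defined nu f (fun x => \sum_i a i *: g i x) /\
  inner nu f (fun x => \sum_i a i *: g i x) = \sum_i a i * inner nu f (g i).
Proof.
move=> fg.
elim: (index_enum I) => [|i r [IHd IHe]].
  rewrite (_ : (fun x => _) = fun=> 0); last by apply/funext => x; rewrite big_nil.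
  rewrite big_nil /inner_defined /inner dot0r; split; first exact: integrable0.
  by rewrite Rintegral_cst// mul0r.
rewrite (_ : (fun x => _) = fun x => a i *: g i x + \sum_(j <- r) a j *: g j x);
  last by apply/funext => x; rewrite big_cons.
rewrite big_cons inner_combr// IHe; split=> //.
exact: inner_defined_combr.
Qed.

Lemma inner_sumr {I : finType} f (a : I -> R) (g : I -> Om -> 'cV[R]_m) :
  (forall i, inner_defined nu f (g i)) ->
  inner nu f (fun x => \sum_i a i *: g i x) = \sum_i a i * inner nu f (g i).
Proof. by move=> fg; have [] := inner_sumr_def a fg. Qed.

Lemma inner_suml {I : finType} (a : I -> R) (f : I -> Om -> 'cV[R]_m) g :
  (forall i, inner_defined nu (f i) g) ->
  inner nu (fun x => \sum_i a i *: f i x) g = \sum_i a i * inner nu (f i) g.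
Proof.
move=> fg; rewrite innerC inner_sumr; last by move=> i; apply: inner_definedC.
by apply: eq_bigr => i _; rewrite innerC.
Qed.

(** <g, A g> is its own opposite, by skewness and symmetry. *)
Lemma skew_adjoint_diag U (A : (Om -> 'cV[R]_m) -> Om -> 'cV[R]_m) g :
  skew_adjoint nu U A -> U g -> inner nu g (A g) = 0.
Proof.
move=> Askew Ug; have := Askew _ _ Ug Ug; rewrite [in RHS]innerC => /eqP.
by rewrite eq_sym eqNr => /eqP.
Qed.

Lemma L2_inner_defined f g : L2 nu f -> L2 nu g -> inner_defined nu f g.
Proof.
move=> Lf Lg; rewrite /inner_defined.
rewrite (_ : _ \o _ = fun x : borel_dom x0 => (\sum_i (f x i 0 * g x i 0)%:E)%E).
  apply: integrable_sum => // i _.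
  exact/Lfun1_integrable/Lfun2_mul_Lfun1.
apply/funext => x /=; rewrite /dot mxE sumEFin; congr EFin.
by apply: eq_bigr => i _; rewrite !mxE.
Qed.

Lemma inner_ge0 f : 0 <= inner nu f f.
Proof.
apply: Rintegral_ge0 => x _; rewrite /dot mxE sumr_ge0// => i _.
by rewrite mxE -expr2 sqr_ge0.
Qed.

Lemma L2_comb (a : R) f g :
  L2 nu f -> L2 nu g -> L2 nu (fun x => a *: f x + g x).
Proof.
move=> Lf Lg i.
rewrite (_ : (fun x => _) = a *: (fun x : borel_dom x0 => f x i 0) +
                            (fun x : borel_dom x0 => g x i 0)); last first.
  by apply/funext => x; rewrite !mxE.
have p1 : (1 <= 2%:E :> \bar R)%E by rewrite lee_fin ler1n.
by have [_] := Lfun_submod_closed nu p1; apply.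
Qed.

Lemma L2_scale (a : R) f : L2 nu f -> L2 nu (fun x => a *: f x).
Proof.
move=> Lf; have -> : (fun x => a *: f x) = (fun x => (a - 1) *: f x + f x).
  by apply/funext => x; rewrite scalerBl scale1r subrK.
exact: L2_comb.
Qed.

Lemma L2_sum {I : finType} (a : I -> R) (f : I -> Om -> 'cV[R]_m) :
  (forall i, L2 nu (f i)) -> L2 nu (fun x => \sum_i a i *: f i x).
Proof.
move=> Lf.
elim: (index_enum I) => [|i r IH].
  move=> i; rewrite (_ : (fun x => _) = 0); last first.
    by apply/funext => x; rewrite big_nil mxE.
  have p1 : (1 <= 2%:E :> \bar R)%E by rewrite lee_fin ler1n.
  by have [] := Lfun_submod_closed nu p1.
rewrite (_ : (fun x => _) = fun x => a i *: f i x + \sum_(j <- r) a j *: f j x);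
  first exact: L2_comb.
by apply/funext => x; rewrite big_cons.
Qed.

(** The parallelogram bound: 2<f,f> + 2<g,g> - <f+g,f+g> = <g-f,g-f> >= 0.  It
    replaces the triangle inequality for the norm in squeeze arguments. *)
Lemma inner_add_le f g : L2 nu f -> L2 nu g ->
  inner nu (fun x => f x + g x) (fun x => f x + g x) <=
  2 * inner nu f f + 2 * inner nu g g.
Proof.
move=> Lf Lg.
have expand (a : R) : inner nu (fun x => a *: f x + g x) (fun x => a *: f x + g x)
    = a ^+ 2 * inner nu f f + 2 * a * inner nu f g + inner nu g g.
  have Lfg := L2_comb a Lf Lg.
  rewrite inner_combr; try exact: L2_inner_defined.
  rewrite [inner nu _ f]innerC [inner nu _ g]innerC.
  rewrite !inner_combr; try exact: L2_inner_defined.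
  by rewrite [inner nu g f]innerC; ring.
have -> : (fun x => f x + g x) = (fun x => 1 *: f x + g x).
  by apply/funext => x; rewrite scale1r.
have := inner_ge0 (fun x => (-1) *: f x + g x).
rewrite !expand; lra.
Qed.

End InnerProduct.

(** * The chain rule for derivatives relative to a set *)

Section ChainRule.
Context {R : realType} {V : normedModType R}.
Implicit Types (T : set R) (g : R -> V) (t : R) (l : V).

Lemma has_deriv_in_cvg_increment T g t l :
  has_deriv_in T g t l -> g s - g t @[s --> within T t^'] --> (0 : V).
Proof.
move=> gl.
have st : s - t @[s --> within T t^'] --> (0 : R).
  rewrite -[X in _ --> X](subrr t); apply: cvgB; last exact: cvg_cst.
  by apply: cvg_within_filter; apply: cvg_within_filter; exact: cvg_id.
have sl : (s - t) *: ((s - t)^-1 *: (g s - g t)) @[s --> within T t^'] -->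
    (0 : R) *: l by exact: cvgZ.
move: sl; rewrite scale0r; apply: cvg_trans; apply: near_eq_cvg.
apply: (cvg_within T); near=> s.
rewrite scalerA divff ?scale1r// subr_eq0.
by near: s; exact: nbhs_dnbhs_neq.
Unshelve. all: by end_near. Qed.

(** [rho] stands for the size of a first-order remainder, such as its norm in
    some function space.  Extended by 0 at the origin, the quotient
    rho(eta)/|eta| is continuous there, so it can be composed with the increment
    of [g] even at times where that increment vanishes. *)
Lemma has_deriv_in_cvg_remainder T g t l (rho : V -> R) :
  has_deriv_in T g t l -> rho 0 = 0 ->
  rho eta / `|eta| @[eta --> 0^'] --> (0 : R) ->
  `|s - t|^-1 * rho (g s - g t) @[s --> within T t^'] --> (0 : R).
Proof.
move=> gl rho0 rhoo.
pose k eta := rho eta / `|eta|.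
have k0 : k 0 = 0 by rewrite /k rho0 mul0r.
have kc : k eta @[eta --> (0 : V)] --> (0 : R).
  by rewrite -[X in _ --> X]k0; apply/continuous_withinNx; rewrite k0.
have kg : k (g s - g t) @[s --> within T t^'] --> (0 : R).
  exact: (cvg_comp _ _ (has_deriv_in_cvg_increment gl) kc).
have kl : k (g s - g t) * `|(s - t)^-1 *: (g s - g t)| @[s --> within T t^']
    --> 0 * `|l| by apply: cvgM => //; exact: cvg_norm.
move: kl; rewrite mul0r; apply: cvg_trans.
rewrite (_ : (fun s => _) = fun s => `|s - t|^-1 * rho (g s - g t))//.
apply/funext => s /=; rewrite /k normrZ normfV.
(* When the increment is null both sides are 0. *)
have [->|g0] := eqVneq (g s - g t) 0; first by rewrite rho0 mulr0 !mul0r.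
by rewrite mulrCA mulfVK// normr_eq0.
Qed.

Lemma has_deriv_in_comp {W : normedModType R} T g t l (F : V -> W) :
  differentiable F (g t) -> has_deriv_in T g t l ->
  has_deriv_in T (F \o g) t ('D_l F (g t)).
Proof.
move=> dF gl; rewrite deriveE//.
pose rem eta := F (g t + eta) - F (g t) - 'd F (g t) eta.
have rem0 : rem 0 = 0 by rewrite /rem addr0 subrr linear0 subrr.
have remo : `|rem eta| / `|eta| @[eta --> (0 : V)^'] --> (0 : R).
  have := diff_locally dF; set o := the_littleo _ _ _ _ _ => dFE.
  have remE eta : rem eta = o eta.
    have := congr1 (@^~ eta) dFE; rewrite /= /rem addrC => ->.
    by rewrite !fctE -[_ - _ - _]addrA -opprD [X in X - _]addrC addrK.
  apply/cvgrPdist_le => e e0; near=> eta.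
  have eta0 : eta != 0 by near: eta; exact: nbhs_dnbhs_neq.
  rewrite sub0r normrN normrM normfV !normr_id ler_pdivrMr ?normr_gt0// remE.
  near: eta; apply: nbhs_dnbhs; exact: littleoP.
have := has_deriv_in_cvg_remainder gl _ remo; rewrite rem0 normr0 => /(_ erefl) r0.
have dl : 'd F (g t) ((s - t)^-1 *: (g s - g t)) @[s --> within T t^'] -->
    'd F (g t) l.
  by apply: (continuous_cvg _ _ gl); exact: (diff_continuous dF).
have r1 : (s - t)^-1 *: rem (g s - g t) @[s --> within T t^'] --> (0 : W).
  by apply/norm_cvg0P; under eq_cvg do rewrite normrZ normfV.
rewrite /has_deriv_in -[X in _ --> X]add0r.
have -> : (fun s => (s - t)^-1 *: ((F \o g) s - (F \o g) t)) =
    fun s => (s - t)^-1 *: rem (g s - g t)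
             + 'd F (g t) ((s - t)^-1 *: (g s - g t)).
  apply/funext => s /=; rewrite linearZ/= -scalerDr /rem subrK.
  by rewrite [g t + _]addrC subrK.
exact: cvgD.
Unshelve. all: by end_near. Qed.

End ChainRule.

(** * L2 differentiability of a parametrized curve *)

Lemma cvg_sumr {R : realType} {S : Type} (F : set_system S) (n : nat) (f : 'I_n -> S -> R)
    (l : 'I_n -> R) : Filter F ->
  (forall i, f i s @[s --> F] --> l i) ->
  \sum_i f i s @[s --> F] --> \sum_i l i.
Proof.
move=> FF fl.
have ac : continuous (fun x : R * R => x.1 + x.2) by move=> x; exact: add_continuous.
exact: (@cvg_big R _ +%R 0 xpredT ac S F _ f l FF (fun i _ => fl i)).
Qed.

Section L2ChainRule.
Context {R : realType} {d m p : nat} {Om : set 'cV[R]_d} {x0 : Om}.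
Variable nu : {measure set (borel_dom x0) -> \bar R}.

Lemma derive_cV_sum {W : normedModType R} (F : 'cV[R]_p -> W) th c :
  differentiable F th -> 'D_c F th = \sum_k c k 0 *: 'D_(delta_mx k 0) F th.
Proof.
move=> dF; rewrite deriveE// {1}[c]matrix_sum_delta linear_sum.
apply: eq_bigr => k _; rewrite big_ord1 linearZ/= deriveE//.
Qed.

(** The squared norm of a combination of fixed L2 functions is a quadratic form
    in the coefficients, whose matrix is the Gram matrix of these functions. *)
Lemma cvg_inner_sum {S : Type} (F : set_system S) (c : S -> 'cV[R]_p)
    (g : 'I_p -> Om -> 'cV[R]_m) :
  Filter F -> (forall k, L2 nu (g k)) -> c s @[s --> F] --> (0 : 'cV[R]_p) ->
  inner nu (fun x => \sum_k c s k 0 *: g k x) (fun x => \sum_k c s k 0 *: g k x)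
    @[s --> F] --> (0 : R).
Proof.
move=> FF Lg c0.
have ck k : c s k 0 @[s --> F] --> (0 : R).
  have := @coord_continuous R p 1 k 0 (0 : 'cV[R]_p); rewrite /continuous_at mxE.
  by move=> ek; exact: (cvg_comp _ _ c0 ek).
have -> : (fun s => inner nu (fun x => \sum_k c s k 0 *: g k x)
                             (fun x => \sum_k c s k 0 *: g k x)) =
          fun s => \sum_k c s k 0 * \sum_l c s l 0 * inner nu (g k) (g l).
  apply/funext => s; rewrite inner_suml; last first.
    by move=> k; apply: L2_inner_defined => //; exact: L2_sum.
  by apply: eq_bigr => k _; rewrite inner_sumr// => l; exact: L2_inner_defined.
have z : \sum_(k < p) 0 * \sum_(l < p) 0 * inner nu (g k) (g l) = 0 :> R.
  by rewrite big1// => k _; rewrite mul0r.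
rewrite -[X in _ --> X]z.
apply: cvg_sumr => k.
apply: cvgM => //; apply: cvg_sumr => l.
by apply: cvgMr_tmp.
Qed.

Lemma L2norm_sqr (f : Om -> 'cV[R]_m) : L2norm nu f ^+ 2 = inner nu f f.
Proof. by rewrite sqr_sqrtr// inner_ge0. Qed.

Lemma L2norm_scale (a : R) (f : Om -> 'cV[R]_m) :
  L2 nu f -> L2norm nu (fun x => a *: f x) = `|a| * L2norm nu f.
Proof.
move=> Lf; rewrite /L2norm.
have -> : inner nu (fun x => a *: f x) (fun x => a *: f x) = a ^+ 2 * inner nu f f.
  rewrite /inner -RintegralZl//; last exact: L2_inner_defined.
  apply: eq_Rintegral => x _; rewrite /dot -scalemxAr linearZ/= -scalemxAl.
  by rewrite !mxE mulrA -expr2.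
by rewrite sqrtrM ?sqr_ge0// sqrtr_sqr.
Qed.

Lemma L2norm0 : L2norm nu (fun=> 0 : 'cV[R]_m) = 0.
Proof.
by rewrite /L2norm /inner dot0r Rintegral_cst// mul0r sqrtr0.
Qed.

(** Frechet differentiability is composed with the parameter curve twice: for
    the values at each point, by the chain rule above, and for the L2 norm, by
    splitting the error of the difference quotient and bounding its squared
    norm. *)
Lemma C1_param_curve (U : set (Om -> 'cV[R]_m)) (uh : 'cV[R]_p -> Om -> 'cV[R]_m)
    (T : set R) (theta dtheta : R -> 'cV[R]_p) :
  (forall v, U v -> L2 nu v) ->
  (forall th, U (uh th)) -> C1_param nu uh ->
  (forall t, T t -> has_deriv_in T theta t (dtheta t)) ->
  differentiable_curve nu U T (uh \o theta)
    (fun t x => 'D_(dtheta t) (uh^~ x) (theta t)).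
Proof.
move=> UL2 Uuh [uhC1 DL2 uhF _] dth t Tt; have dtht := dth _ Tt.
have duh x th : differentiable (uh^~ x) th by have [] := uhC1 x.
split; [exact: Uuh|exact: DL2|by move=> x; apply: has_deriv_in_comp|].
pose rem eta x := uh (theta t + eta) x - uh (theta t) x
                  - 'D_eta (uh ^~ x) (theta t).
have Lrem eta : L2 nu (rem eta).
  have -> : rem eta = fun x => (-1) *: 'D_eta (uh ^~ x) (theta t)
      + ((-1) *: uh (theta t) x + uh (theta t + eta) x).
    by apply/funext => x; rewrite !scaleN1r addrC [X in X - _]addrC.
  by do 2 (apply: L2_comb; [by auto|]); auto.
pose g k x := 'D_(delta_mx k 0 : 'cV[R]_p) (uh ^~ x) (theta t).
have rem0 : L2norm nu (rem 0) = 0.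
  rewrite -[RHS]L2norm0; congr L2norm; apply/funext => x.
  by rewrite /rem addr0 derive0 !subrr.
have r0 := has_deriv_in_cvg_remainder dtht rem0 (uhF (theta t)).
pose c s := (s - t)^-1 *: (theta s - theta t) - dtheta t.
have c0 : c s @[s --> within T t^'] --> (0 : 'cV[R]_p).
  by rewrite -[X in _ --> X](subrr (dtheta t)); apply: cvgB; [exact: dtht|exact: cvg_cst].
have Lg k : L2 nu (g k) by exact: DL2.
have q0 := cvg_inner_sum _ Lg c0.
(* The quotient of the remainder, plus the derivative in the direction by which
   the quotient of [theta] misses its limit. *)
have split_quotient s :
  (fun x => (s - t)^-1 *: (uh (theta s) x - uh (theta t) x)
            - 'D_(dtheta t) (uh^~ x) (theta t)) =
  (fun x => (s - t)^-1 *: rem (theta s - theta t) x + \sum_k c s k 0 *: g k x).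
  apply/funext => x; rewrite -derive_cV_sum//.
  have -> : 'D_(c s) (uh^~ x) (theta t) =
      (s - t)^-1 *: 'D_(theta s - theta t) (uh^~ x) (theta t)
      - 'D_(dtheta t) (uh^~ x) (theta t) by rewrite !deriveE// linearB linearZ.
  by rewrite /rem [theta t + _]addrC subrK [in RHS]scalerBr addrA subrK.
have sq0 : inner nu (fun x => (s - t)^-1 *: (uh (theta s) x - uh (theta t) x)
              - 'D_(dtheta t) (uh^~ x) (theta t))
           (fun x => (s - t)^-1 *: (uh (theta s) x - uh (theta t) x)
              - 'D_(dtheta t) (uh^~ x) (theta t))
    @[s --> within T t^'] --> (0 : R).
  pose bound s := 2 * (`|s - t|^-1 * L2norm nu (rem (theta s - theta t))) ^+ 2
    + 2 * inner nu (fun x => \sum_k c s k 0 *: g k x)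
                   (fun x => \sum_k c s k 0 *: g k x).
  have b0 : bound s @[s --> within T t^'] --> (0 : R).
    have z : 2 * (0 * 0) + 2 * 0 = 0 :> R by rewrite !mulr0 addr0.
    rewrite -[X in _ --> X]z; apply: cvgD; apply: cvgMl_tmp; last exact: q0.
    by under eq_cvg do rewrite expr2; apply: cvgM.
  apply: (squeeze_cvgr _ (cvg_cst 0) b0); apply: nearW => s.
  rewrite inner_ge0/= split_quotient /bound -normfV -L2norm_scale// L2norm_sqr.
  by apply: inner_add_le; [exact: L2_scale|exact: L2_sum].
rewrite -[X in _ --> X]sqrtr0.
by apply: (continuous_cvg _ _ sq0); exact: sqrt_continuous.
Qed.

End L2ChainRule.

(** * Separable parametrizations *)

Section Separable.
Context {R : realType} {d m nPhi : nat} {q_ : 'I_nPhi -> nat}.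
Context {Om : set 'cV[R]_d}.
Variable phi : forall i : 'I_nPhi, Om -> 'cV[R]_(q_ i) -> R.
Local Notation q := (\sum_(i < nPhi) q_ i)%N.
Local Notation nb := (nPhi * m)%N.
Local Notation V := (@Vmx R d m nPhi q_ Om phi).
Local Notation uh := (@uhat R d m nPhi q_ Om phi).
Implicit Types (alpha : 'cV[R]_q) (beta : 'cV[R]_nb).

Lemma sum_mxtens (F : 'I_nb -> R) :
  \sum_k F k = \sum_i \sum_j F (mxtens_index (i, j)).
Proof.
rewrite pair_big_dep /=.
rewrite (reindex (fun ij : 'I_nPhi * 'I_m => mxtens_index ij)) /=; last first.
  by exists (@mxtens_unindex nPhi m) => k _; rewrite ?mxtens_indexK ?mxtens_unindexK.
by apply: eq_bigr => -[].
Qed.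

Lemma VmxE x alpha (r : 'I_m) i j :
  V x alpha r (mxtens_index (i, j)) =
  phi x (submxcol alpha i) * (r == j)%:R.
Proof.
rewrite /Vmx castmxE /= cast_ord_id.
rewrite (_ : cast_ord _ r = mxtens_index (ord0 : 'I_1, r)); last first.
  by apply: val_inj; rewrite /= mul0n.
by rewrite tensmxE !mxE.
Qed.

Lemma uhatE alpha beta x :
  uh (col_mx alpha beta) x = V x alpha *m beta.
Proof.
apply/colP => r; rewrite /uhat col_mxKu col_mxKd summxE [RHS]mxE sum_mxtens.
apply: eq_bigr => i _; rewrite (bigD1 r)//= big1 ?addr0; last first.
  by move=> j jr; rewrite VmxE eq_sym (negbTE jr) mulr0 mul0r.
by rewrite VmxE eqxx mulr1 !mxE.
Qed.

Lemma uhat_split theta x :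
  uh theta x = V x (usubmx theta) *m dsubmx theta.
Proof. by rewrite -{1}[theta]vsubmxK uhatE. Qed.

Lemma mulmx_col_sum {n p : nat} (A : 'M[R]_(n, p)) (b : 'cV[R]_p) :
  A *m b = \sum_k b k 0 *: (A *m delta_mx k 0).
Proof.
rewrite {1}[b]matrix_sum_delta mulmx_sumr; apply: eq_bigr => k _.
by rewrite big_ord1 -scalemxAr.
Qed.

Hypothesis uhatC1 : forall x, C1 (uh ^~ x).

Lemma uhat_differentiable x theta : differentiable (uh ^~ x) theta.
Proof. by have [] := uhatC1 x. Qed.

(** Moving only [alpha] in [uhat] keeps [beta] fixed, so the derivatives of
    [V alpha *m beta] are among the directional derivatives of [uhat]. *)
Lemma is_derive_Vmx_mul x alpha beta (a : 'cV[R]_q) :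
  is_derive alpha a (fun al => V x al *m beta)
    ('D_(col_mx a 0) (uh ^~ x) (col_mx alpha beta)).
Proof.
have E : (fun h : R => h^-1 *: (V x (h *: a + alpha) *m beta
                                  - V x alpha *m beta)) =
  fun h => h^-1 *: (uh (h *: col_mx a 0 + col_mx alpha beta) x
                                  - uh (col_mx alpha beta) x).
  apply/funext => h.
  by rewrite scale_col_mx scaler0 add_col_mx add0r !uhatE.
have D : derivable (uh ^~ x) (col_mx alpha beta) (col_mx a 0).
  exact/diff_derivable/uhat_differentiable.
by split; rewrite /derivable /derive E.
Qed.

(** [V] inherits the differentiability of [uhat], since its columns are the
    values of [uhat] at the unit coefficient vectors [beta]. *)
Lemma derivable_Vmx x alpha a : derivable (V x) alpha a.
Proof.
apply/derivable_mxP => r k.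
have -> : (fun al => V x al r k) =
          fun al => (V x al *m (delta_mx k 0 : 'cV[R]_nb)) r 0.
  by apply/funext => al; rewrite -colE mxE.
have [dVk _] := is_derive_Vmx_mul x alpha (delta_mx k 0) a.
exact: ((derivable_mxP _ _ _).1 dVk r 0).
Qed.

Lemma derive_Vmx_mul x alpha beta a :
  'D_a (fun al => V x al *m beta) alpha =
  'D_a (V x) alpha *m beta.
Proof.
have dV : derivable (V x) alpha a by exact: derivable_Vmx.
have dVb : derivable (fun al => V x al *m beta) alpha a.
  by have [] := is_derive_Vmx_mul x alpha beta a.
rewrite !derive_mx//; apply/matrixP => r c; rewrite !mxE.
have -> : (fun al => (V x al *m beta) r c) =
    \sum_k (fun al => beta k c *: V x al r k).
  by apply/funext => al; rewrite mxE fct_sumE; apply: eq_bigr => k _;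
    rewrite mulrC.
have dVrk k : derivable (fun al => V x al r k) alpha a.
  exact: ((derivable_mxP _ _ _).1 dV).
rewrite derive_sum; last by move=> k; apply: derivableZ.
by apply: eq_bigr => k _; rewrite deriveZ// mxE mulrC.
Qed.

Lemma derive_uhat_beta x alpha beta b :
  'D_(col_mx 0 b) (uh ^~ x) (col_mx alpha beta) = V x alpha *m b.
Proof.
rewrite /derive; apply/cvg_lim => //; apply: cvg_near_cst; near=> h.
have h0 : h != 0 by near: h; exact: nbhs_dnbhs_neq.
rewrite /= scale_col_mx scaler0 add_col_mx add0r !uhatE.
by rewrite mulmxDr addrK -scalemxAr scalerA mulVf// scale1r.
Unshelve. all: by end_near. Qed.

(** Linearity of the differential splits the direction [c] into coordinates of
    [alpha], each of which only moves [V], and the [beta] part, in which [uhat]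
    is linear. *)
Lemma derive_uhat theta (c : 'cV[R]_(q + nb)) x :
  'D_c (uh ^~ x) theta =
  \sum_i usubmx c i 0 *: dV_beta phi theta i x
  + \sum_k dsubmx c k 0 *: V_unit phi theta k x.
Proof.
have cE : c = \sum_i usubmx c i 0 *: col_mx (delta_mx i 0 : 'cV[R]_q) 0
              + col_mx 0 (dsubmx c).
  have colD : {morph (fun a => col_mx a 0 : 'cV[R]_(q + nb)) : a b / a + b}.
    by move=> a b; rewrite add_col_mx addr0.
  rewrite -[LHS]vsubmxK -[usubmx c in LHS]addr0 -[dsubmx c in LHS]add0r.
  rewrite -add_col_mx; congr (_ + _).
  rewrite [in LHS](matrix_sum_delta (usubmx c)) (big_morph _ colD (col_mx0 _ _ _ _)).
  by apply: eq_bigr => i _; rewrite big_ord1 scale_col_mx scaler0.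
rewrite deriveE; last exact: uhat_differentiable.
rewrite {1}cE linearD linear_sum/=; congr (_ + _).
  apply: eq_bigr => i _; rewrite linearZ/=; congr (_ *: _).
  rewrite -deriveE; last exact: uhat_differentiable.
  rewrite /dV_beta -derive_Vmx_mul -{1}[theta]vsubmxK.
  by have [_ ->] := is_derive_Vmx_mul x (usubmx theta) (dsubmx theta) (delta_mx i 0).
rewrite -deriveE; last exact: uhat_differentiable.
by rewrite -mulmx_col_sum -{1}[theta]vsubmxK derive_uhat_beta.
Qed.

End Separable.

(** * Galerkin orthogonality *)

Section GalerkinOrthogonality.
Context {R : realType} {d m nPhi : nat} {q_ : 'I_nPhi -> nat}.
Context {Om : set 'cV[R]_d} {x0 : Om}.
Variable nu : {measure set (borel_dom x0) -> \bar R}.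
Variable J : (Om -> 'cV[R]_m) -> (Om -> 'cV[R]_m) -> (Om -> 'cV[R]_m).
Variable Q : 'cV[R]_m -> 'M[R]_m.
Variable phi : forall i : 'I_nPhi, Om -> 'cV[R]_(q_ i) -> R.
Local Notation q := (\sum_(i < nPhi) q_ i)%N.
Local Notation nb := (nPhi * m)%N.
Local Notation uh := (@uhat R d m nPhi q_ Om phi).
Implicit Types (theta c : 'cV[R]_(q + nb)).

Hypothesis uhatC1 : forall x, C1 (uh ^~ x).
Hypothesis Qsym : forall y, (Q y)^T = Q y.
Hypothesis wd : MQ_FQ_well_defined nu J Q phi.

Lemma dot_QmulC (v f g : Om -> 'cV[R]_m) :
  dot (x0 := x0) (Qmul Q v f) g = dot (Qmul Q v g) f.
Proof.
rewrite [RHS]dotC; apply/funext => x.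
by rewrite /dot /Qmul trmx_mul Qsym mulmxA.
Qed.

Lemma inner_QmulC (v f g : Om -> 'cV[R]_m) :
  inner nu (Qmul Q v f) g = inner nu (Qmul Q v g) f.
Proof. by rewrite /inner dot_QmulC. Qed.

(** The lower block row of [MQ *m c] tests the tangent vector with parameter
    velocity [c] against the weighted columns of [V].  The lower left block of
    [MQ] is the transpose of [M12], which has the weight on the other factor;
    the symmetry of [Q] moves it. *)
Lemma inner_derive_uhat theta c k :
  let dv := fun x => 'D_c (uh ^~ x) theta in
  inner_defined nu (Qmul Q (uh theta) (V_unit phi theta k)) dv /\
  inner nu (Qmul Q (uh theta) (V_unit phi theta k)) dv =
  dsubmx (MQ nu Q phi theta *m c) k 0.
Proof.
have [_ wd12 wd22 _ _] := wd theta.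
set QV := Qmul _ _ _.
have VdV i : inner_defined nu QV (dV_beta phi theta i).
  by rewrite /inner_defined /QV dot_QmulC; exact: wd12.
have [dA eA] := inner_sumr_def (fun i => usubmx c i 0) VdV.
have [dB eB] := inner_sumr_def (fun l => dsubmx c l 0) (wd22 k).
have -> : (fun x => 'D_c (uh ^~ x) theta) =
    (fun x => 1 *: (\sum_i usubmx c i 0 *: dV_beta phi theta i x)
              + \sum_l dsubmx c l 0 *: V_unit phi theta l x).
  by apply/funext => x; rewrite scale1r derive_uhat.
split; first exact: inner_defined_combr.
rewrite inner_combr// mul1r eA eB /MQ -{3}[c]vsubmxK mul_block_col col_mxKd.
rewrite [RHS]mxE; congr (_ + _); rewrite mxE; apply: eq_bigr => i _.
  by rewrite !mxE /QV inner_QmulC mulrC.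
by rewrite !mxE mulrC.
Qed.

(** Since [uhat = V *m beta], the weighted state is a combination of the test
    functions of the lower block row, with weights [beta]. *)
Lemma inner_Quhat_derive theta c :
  MQ nu Q phi theta *m c = FQ nu J Q phi theta ->
  inner nu (Qmul Q (uh theta) (uh theta)) (fun x => 'D_c (uh ^~ x) theta) =
  inner nu (Qmul Q (uh theta) (uh theta)) (rhs J Q phi theta).
Proof.
move=> Mc; have [_ _ _ _ wdF] := wd theta.
have QuE : Qmul Q (uh theta) (uh theta) =
    fun x => \sum_k dsubmx theta k 0 *: Qmul Q (uh theta) (V_unit phi theta k) x.
  apply/funext => x; rewrite /Qmul [X in _ *m X = _]uhat_split.
  rewrite (mulmx_col_sum (Vmx _ _ _)) mulmx_sumr.
  by apply: eq_bigr => k _; rewrite -scalemxAr.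
rewrite QuE !inner_suml//; last by move=> k; have [] := inner_derive_uhat theta c k.
apply: eq_bigr => k _; congr (_ * _).
by have [_ ->] := inner_derive_uhat theta c k; rewrite Mc /FQ col_mxKd mxE.
Qed.

End GalerkinOrthogonality.

(** * Conservation of the Hamiltonian *)

Theorem proposition1
  (R : realType)
  (T : set R) (hT : nondegenerate_interval T)
  (d m : nat) (Om : set 'cV[R]_d) (x0 : Om)
  (nu : {measure set (borel_dom x0) -> \bar R}) (hnu : fully_supported nu)
  (U Z : set (Om -> 'cV[R]_m))
  (hU : L2_subspace nu U) (hZ : L2_subspace nu Z)
  (f : Om -> (Om -> 'cV[R]_m) -> 'cV[R]_m)
  (J : (Om -> 'cV[R]_m) -> (Om -> 'cV[R]_m) -> (Om -> 'cV[R]_m))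
  (H : (Om -> 'cV[R]_m) -> R)
  (dH : (Om -> 'cV[R]_m) -> (Om -> 'cV[R]_m))
  (hJ : forall v, U v -> linear_operator U Z (J v))
  (hJskew : forall v, U v -> skew_adjoint nu U (J v))
  (hdH : variational_derivative nu U H dH)
  (hf : forall v, U v -> forall x, f x v = J v (dH v) x)
  (h : 'cV[R]_m -> R) (Q : 'cV[R]_m -> 'M[R]_m)
  (hHQ : factorizable nu U H dH h Q)
  (nPhi : nat) (q_ : 'I_nPhi -> nat)
  (phi : forall i : 'I_nPhi, Om -> 'cV[R]_(q_ i) -> R)
  (huU : forall theta, U (uhat phi theta))
  (huC1 : C1_param nu (@uhat R d m nPhi q_ Om phi))
  (hMF : MQ_FQ_well_defined nu J Q phi)
  (theta dtheta : R -> 'cV[R]_((\sum_(i < nPhi) q_ i) + nPhi * m))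
  (hsol : NG_solution nu J Q phi T theta dtheta) :
  forall t, T t -> has_deriv_in T (fun s => H (uhat phi (theta s))) t 0.
Proof.
move=> t Tt.
have [UL2 _ _] := hU.
have [_ Qsp _ dHE] := hHQ.
have [uhC1 _ _ _] := huC1.
have [UdH chain] := hdH.
pose u := uhat phi (theta t).
pose dv s x := 'D_(dtheta s) (uhat (m := m) phi ^~ x) (theta s).
have curve : differentiable_curve nu U T (uhat phi \o theta) dv.
  by apply: C1_param_curve => // s Ts; have [] := hsol s Ts.
suff <- : inner nu (dH u) (dv t) = 0 by exact: (chain T _ _ hT curve t Tt).
have dHu : dH u = Qmul Q u u.
  by apply/funext => x; rewrite dHE//; exact: huU.
have [_ Mc] := hsol t Tt.
rewrite dHu (@inner_Quhat_derive _ _ _ _ _ _ _ nu J)//; last by move=> y; have [] := Qsp y.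
rewrite /rhs -/u -dHu; apply: (skew_adjoint_diag (hJskew _ (huU _))).
by apply: UdH; exact: huU.
Qed.
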